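(* Let $\Omega\subset\mathbb{C}$ be open and connected, and let $f:\Omega\to\mathbb{C}$ be analytic and non-constant. Then: (a) (Maximum Modulus Principle) $|f|$ has no local maximum in $\Omega$. (b) (Minimum Modulus Principle) $|f|$ has no local minimum at a point $z_0\in\Omega$, unless $f(z_0)=0$.
   Context: A function $f:\Omega\to\mathbb{C}$ on an open set $\Omega\subset\mathbb{C}$ is analytic if for each $z_0\in\Omega$ there exist $r>0$ and constants $c_n\in\mathbb{C}$ ($n\ge 0$) such that $D(z_0;r)=\{z:|z-z_0|<r\}\subset\Omega$ and $f(z)=\sum_{n=0}^{+\infty}c_n(z-z_0)^n$ for all $z\in D(z_0;r)$. Local maxima and minima are not required to be strict. *)

(* Defs.v *)
From HB Require Import structures.
From mathcomp Require Import all_boot all_order all_algebra.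
From mathcomp Require Import all_classical all_reals all_analysis.
From mathcomp Require Import complex.
Set Implicit Arguments.
Unset Strict Implicit.
Unset Printing Implicit Defensive.
Import Order.TTheory GRing.Theory Num.Theory.
Import numFieldNormedType.Exports.
Local Open Scope classical_set_scope.
Local Open Scope ring_scope.
Local Open Scope complex_scope.

(* The complex plane is R[i]^o rather than R[i]: MathComp-Analysis attaches   *)
(* the topology of a numFieldType to its regular module, so the bare R[i] has *)
(* none.  The norm and the ball radii live in R[i]; its order only compares   *)
(* numbers with the same imaginary part, hence is the order of R on moduli.   *)
(* A function on Omega is given as a total function, of which only the values *)
(* on Omega are ever used.                                                    *)

Definition analytic_on (R : realType) (Omega : set R[i]^o)
    (f : R[i]^o -> R[i]^o) : Prop :=
  forall z0 : R[i]^o, Omega z0 ->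
  exists (r : R) (c : nat -> R[i]^o),
    [/\ 0 < r,
        ball z0 r%:C `<=` Omega &
        forall z : R[i]^o, ball z0 r%:C z ->
          series (fun n => c n * (z - z0) ^+ n) @ \oo --> f z].

Definition constant_on (T U : Type) (A : set T) (f : T -> U) : Prop :=
  exists c : U, forall x : T, A x -> f x = c.

Definition local_max_in (T : topologicalType) (K : numDomainType)
    (A : set T) (g : T -> K) (x0 : T) : Prop :=
  A x0 /\ \forall x \near within A (nbhs x0), g x <= g x0.

Definition local_min_in (T : topologicalType) (K : numDomainType)
    (A : set T) (g : T -> K) (x0 : T) : Prop :=
  A x0 /\ \forall x \near within A (nbhs x0), g x0 <= g x.

(* Main.v *)
Require Import Defs.
From HB Require Import structures.
From mathcomp Require Import all_boot all_order all_algebra.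
From mathcomp Require Import all_classical all_reals all_analysis.
From mathcomp Require Import complex ring.
Set Implicit Arguments.
Unset Strict Implicit.
Unset Printing Implicit Defensive.
Import Order.TTheory GRing.Theory Num.Theory.
Import numFieldNormedType.Exports.
Local Open Scope classical_set_scope.
Local Open Scope ring_scope.
Local Open Scope complex_scope.

(** Near each point z0 of its domain, and for any constant c, an analytic
    function f either equals c or satisfies
      f z = c + a (z - z0)^k + R(z),   a != 0,   |R(z)| <= |a (z - z0)^k| / 2,
    because in the expansion of f - c the terms after the first nonzero one
    add up to O(|z - z0|^(k+1)) ([power_series_leading_term],
    [analytic_leading_term]).  Everything follows from this dichotomy.

    First, in the second case f differs from c on a punctured neighbourhood of
    z0, so inside the domain the set where f is locally equal to c is closed;
    it is visibly open, so on a connected domain a locally constant f is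
    constant ([locally_constant_constant]).  A non-constant f is therefore
    locally constant nowhere.

    Second, take c = f z0, so that k > 0.  Given any direction v != 0, a k-th
    root w of v / a gives a w^k = v, and moving from z0 to z0 + s w changes f
    by t v with t = s^k, up to an error smaller than t |v|
    ([analytic_moves_along]).  With v = f z0 (or v = 1 when f z0 = 0) the
    modulus grows to |f z0| + t |v| minus less than t |v|, which exceeds
    |f z0|: there is no local maximum.  With v = - f z0 != 0 it shrinks to
    (1 - t) |f z0| plus less than t |f z0|: there is no local minimum. *)

(** * Sums, limits and monomials *)

Lemma geometric_tail_le (K : numDomainType) (q : K) (m N : nat) :
  0 <= q -> q *+ 2 <= 1 -> \sum_(m <= n < N) q ^+ n <= q ^+ m *+ 2.
Proof.
move=> q0 q21; have [Nm|/ltnW mN] := leqP N m.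
  by rewrite big_geq// mulrn_wge0// exprn_ge0.
(* Since 2 q <= 1, each q^n is at most the telescoping difference below. *)
apply: (@le_trans _ _ (\sum_(m <= n < N) (q ^+ n *+ 2 - q ^+ n.+1 *+ 2))).
  apply: ler_sum => n _.
  rewrite exprS -mulrnAl mulr2n -addrA lerDl -{1}[q ^+ n]mul1r -mulrBl.
  by rewrite mulr_ge0 ?subr_ge0 ?exprn_ge0.
have -> : \sum_(m <= n < N) (q ^+ n *+ 2 - q ^+ n.+1 *+ 2) =
    q ^+ m *+ 2 - q ^+ N *+ 2.
  rewrite (telescope_sumr_eq (fun n => - (q ^+ n *+ 2)))//.
    by rewrite opprK addrC.
  by move=> i _; rewrite opprK addrC.
by rewrite gerBl mulrn_wge0// exprn_ge0.
Qed.

(** The scalars may be complex, where order is only partial: the argument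
    compares `|l| with B, which is possible because both are real. *)
Lemma norm_limit_le (K : numFieldType) (V : normedModType K) (u : V ^nat)
    (l : V) (B : K) (m : nat) :
  u @ \oo --> l -> 0 <= B -> (forall n, (m <= n)%N -> `|u n| <= B) -> `|l| <= B.
Proof.
move=> ul B0 uB; rewrite real_leNgt ?ger0_real//; apply/negP => Bl.
have [N _ Nu] := cvgr_norm_gt _ ul _ Bl.
have := lt_le_trans (Nu _ (leq_maxr m N)) (uB _ (leq_maxl m N)).
by rewrite ltxx.
Qed.

Lemma norm_le_half_eq0 (K : numFieldType) (x : K) :
  `|x| <= 2^-1 * `|x| -> x = 0.
Proof.
move=> xh; apply/eqP; apply: contraTT xh => x0.
by rewrite ler_pMl ?normr_gt0// invf_ge1// lern1.
Qed.

Lemma monomial_neq0 (K : fieldType) (a z w : K) (k : nat) :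
  a != 0 -> w != z -> a * (w - z) ^+ k != 0.
Proof. by move=> a0 wz; rewrite mulf_neq0// expf_neq0// subr_eq0. Qed.

(** * Leading term of a power series *)

(** The terms of a convergent series tend to zero, hence are bounded: this
    Cauchy-type estimate on the coefficients is all that is needed to
    control tails inside half the radius. *)
Lemma power_series_coeff_bound (K : numFieldType) (c : nat -> K^o) (s : K) :
  cvgn (series (fun n => (c n * s ^+ n : K^o))) ->
  exists2 B, 0 < B & forall n, `|c n| * `|s| ^+ n <= B.
Proof.
move=> cs; have : cvgn (fun n => (c n * s ^+ n : K^o)).
  by apply/cvg_ex; exists 0; exact: cvg_series_cvg_0.
move=> /cvg_seq_bounded/pinfty_ex_gt0[B B0 /= cB].
by exists B => // n; rewrite -normrX -normrM; exact: cB.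
Qed.

(** With k the least index of a nonzero coefficient and s < r, the estimate
    `|u n| <= B / s ^ n compares the tail after u k h^k with a geometric
    series of ratio q = `|h| / s, so that the tail is at most
    2 B q^(k+1).  This is a multiple of `|h|^(k+1), hence at most half of
    `|u k h^k| once h is small. *)
Lemma power_series_leading_term (K : numFieldType) (u : nat -> K^o)
    (g : K^o -> K^o) (r : K) :
  0 < r ->
  (forall h : K^o, `|h| < r -> series (fun n => u n * h ^+ n) @ \oo --> g h) ->
  (forall h, `|h| < r -> g h = 0) \/
  exists k (a : K) (d : K), [/\ a != 0, 0 < d &
    forall h : K^o, `|h| < d -> `|g h - a * h ^+ k| <= 2^-1 * `|a * h ^+ k|].
Proof.
move=> r0 ug; have [u0|] := pselect (forall n, u n = 0).
  left=> h hr; apply/(cvg_unique _ (ug h hr)) => //=.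
  rewrite [X in X @ _ --> _](_ : _ = fun=> 0); first exact: cvg_cst.
  by apply/funext => n; rewrite seriesEnat/= big1// => i _; rewrite u0 mul0r.
move=> /existsNP[n0 /eqP un0].
right; have exu : exists n, u n != 0 by exists n0.
case: (ex_minnP exu) => k uk0 kmin.
pose s := r / 2.
have s0 : 0 < s by rewrite divr_gt0.
have sr : `|s| < r by rewrite gtr0_norm// ltr_pdivrMr// ltr_pMr// ltr1n.
have [B B0 uB] := power_series_coeff_bound (cvgP _ (ug s sr)).
rewrite gtr0_norm// in uB.
(* For `|h| < d1 the bound 2 B q^(k+1) is at most `|u k| `|h|^k / 2; for
   `|h| < s / 2 the ratio q is at most 1 / 2. *)
pose d1 := `|u k| * s ^+ k.+1 / (B * 4).
have d10 : 0 < d1 by rewrite divr_gt0 ?mulr_gt0 ?exprn_gt0 ?normr_gt0.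
pose d := Num.min (s / 2) d1.
exists k, (u k), d; split => //.
  by rewrite /d minElt; case: ifP => _ //; rewrite divr_gt0.
move=> h.
have s20 : 0 < s / 2 by rewrite divr_gt0.
have cmp : s / 2 >=< d1 by apply: real_comparable; exact: gtr0_real.
rewrite /d comparable_lt_min//; move=> /andP[hs hd].
have hr : `|h| < r.
  apply: (lt_trans hs); apply: lt_le_trans (ltW sr).
  by rewrite gtr0_norm// ltr_pdivrMr// ltr_pMr// ltr1n.
pose q := `|h| / s.
have q0 : 0 <= q by rewrite divr_ge0// ltW.
have q2 : q *+ 2 <= 1.
  rewrite -mulr_natr mulrAC ler_pdivrMr// mul1r -ler_pdivlMr//.
  exact: ltW.
have tail0 : 0 <= B * (q ^+ k.+1 *+ 2).
  by rewrite mulr_ge0 ?mulrn_wge0 ?exprn_ge0// ltW.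
apply: (@le_trans _ _ (B * (q ^+ k.+1 *+ 2))).
  have splitE (N : nat) : (k < N)%N ->
      \sum_(0 <= n < N) u n * h ^+ n - u k * h ^+ k
      = \sum_(k.+1 <= n < N) u n * h ^+ n :> K.
    move=> kN; rewrite (big_cat_nat (n := k))//=; last exact: ltnW.
    rewrite big_nat big1 ?add0r => [|n /andP[_ nk]].
      by rewrite big_ltn// addrAC subrr add0r.
    apply/eqP; rewrite mulf_eq0; apply/orP; left; apply: contraTT nk => un.
    by rewrite -leqNgt kmin.
  apply: (norm_limit_le (m := k.+1)
    (cvgB (ug h hr) (cvg_cst (u k * h ^+ k)))) => //.
  move=> N /splitE kN; rewrite seriesEnat [X in `|X|]kN.
  apply: le_trans (ler_norm_sum _ _ _) _.
  apply: (@le_trans _ _ (\sum_(k.+1 <= n < N) B * q ^+ n)).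
    apply: ler_sum => n _; rewrite normrM normrX /q expr_div_n mulrA.
    rewrite ler_pdivlMr ?exprn_gt0// mulrAC ler_wpM2r ?exprn_ge0//.
  by rewrite -mulr_sumr ler_wpM2l ?geometric_tail_le// ltW.
rewrite normrM normrX /q expr_div_n exprS.
rewrite /d1 ltr_pdivlMr ?mulr_gt0// in hd.
have -> : B * ((`|h| * `|h| ^+ k / s ^+ k.+1) *+ 2) =
  2^-1 * ((`|h| * (B * 4)) * `|h| ^+ k / s ^+ k.+1).
  by field; rewrite ?expf_neq0// gt_eqF.
rewrite ler_wpM2l ?invr_ge0// ler_pdivrMr ?exprn_gt0// [leRHS]mulrAC.
by rewrite ler_wpM2r ?exprn_ge0// ltW.
Qed.

(** * Analytic functions *)

Section analytic.
Variables (R : realType) (Omega : set R[i]^o) (f : R[i]^o -> R[i]^o).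
Hypothesis f_analytic : analytic_on Omega f.

(** Subtracting c only alters the constant coefficient of the expansion of f
    at z0.  The constant c is independent of f z0: the identity theorem
    compares f with the value it takes elsewhere. *)
Lemma analytic_leading_term (z0 c : R[i]^o) : Omega z0 ->
  (\forall z \near z0, f z = c) \/
  exists k (a : R[i]), a != 0 /\ \forall z \near z0,
    `|f z - c - a * (z - z0) ^+ k| <= 2^-1 * `|a * (z - z0) ^+ k|.
Proof.
move=> /f_analytic[r [b [r0 _ fb]]].
have rC0 : 0 < r%:C by rewrite ltcR.
pose u n : R[i]^o := b n - (if n == 0%N then c else 0).
have ug (h : R[i]^o) : `|h| < r%:C ->
    series (fun n => u n * h ^+ n) @ \oo --> f (z0 + h) - c.
  move=> hr; have zb : ball z0 r%:C (z0 + h).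
    by rewrite -ball_normE /ball_/= opprD addNKr normrN.
  apply: cvg_trans (cvgB (fb _ zb) (cvg_cst c)); apply: near_eq_cvg.
  (* The two partial sums agree once they contain the constant term. *)
  near=> n; have n0 : (0 < n)%N by near: n; exists 1%N.
  rewrite !seriesEnat [RHS](_ : _ = \sum_(0 <= i < n) u i * h ^+ i)//.
  rewrite (_ : \sum_(0 <= i < n) u i * h ^+ i =
    \sum_(0 <= i < n) b i * (z0 + h - z0) ^+ i - c :> R[i])//.
  rewrite big_ltn// [in RHS]big_ltn// /u !expr0 !mulr1 [RHS]addrAC.
  congr (_ + _); apply: eq_big_nat => i /andP[i0 _].
  by rewrite gtn_eqF// subr0 addrAC subrr add0r.
have [g0|[k [a [d [a0 d0 gd]]]]] := power_series_leading_term rC0 ug.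
  left; apply/nbhs_ballP; exists r%:C => // z.
  rewrite -ball_normE /ball_/= distrC => /g0.
  by rewrite [z0 + _]addrC subrK => /eqP; rewrite subr_eq0 => /eqP.
right; exists k, a; split=> //; apply/nbhs_ballP; exists d => // z.
rewrite -ball_normE /ball_/= distrC => /gd.
by rewrite [z0 + _]addrC subrK.
Unshelve. all: by end_near. Qed.

(** Identity theorem for constants.  The set B of points near which f equals
    c is relatively closed: at a limit point z of B outside B, f would take
    the value c at points of B other than z and arbitrarily close to it,
    whereas f - c cannot vanish where its leading term a (w - z)^k is nonzero
    and approximates it within half of its modulus. *)
Lemma locally_constant_constant (z0 : R[i]^o) (c : R[i]^o) :
  connected Omega -> Omega z0 -> (\forall z \near z0, f z = c) ->
  constant_on Omega f.
Proof.
move=> Oc Oz0 fz0; exists c.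
pose B : set R[i]^o := Omega `&` interior [set z | f z = c].
suff BO : B = Omega by move=> z; rewrite -BO => -[_ /interior_subset].
apply: Oc; first by exists z0.
  by exists (interior [set z | f z = c]) => //; exact: open_interior.
exists (closure B); first exact: closed_closure.
apply/seteqP; split=> [z Bz|z [Oz clz]].
  by split; [case: Bz|exact: subset_closure].
split; first exact: Oz.
have [fc|[k [a [a0 fa]]]] := analytic_leading_term c Oz; first exact: fc.
have [w [[Ow wc] /= fw]] := clz _ fa.
have [<-|wz] := eqVneq w z; first exact: wc.
move: fw; rewrite (interior_subset wc) subrr sub0r normrN.
move=> /norm_le_half_eq0/eqP az; case/negP: (monomial_neq0 k a0 wz).
exact: az.
Qed.

(** The core of both modulus principles, and a weak form of the open mapping
    theorem: arbitrarily close to z0, f moves away from f z0 in any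
    prescribed direction v, with a relative error less than 1. *)
Lemma analytic_moves_along (z0 : R[i]^o) (v : R[i]) (U : set R[i]^o) :
  Omega z0 -> ~ (\forall z \near z0, f z = f z0) -> v != 0 -> nbhs z0 U ->
  exists (z : R[i]^o) (t : R[i]),
    [/\ U z, 0 < t, t <= 1 & `|f z - (f z0 + t * v)| < t * `|v|].
Proof.
move=> Oz0 fN v0 Uz0.
have [fc|[k [a [a0 fa]]]] := analytic_leading_term (f z0) Oz0.
  by case: fN.
(* For k = 0 the leading term would be a constant a != 0 at distance at most
   `|a| / 2 from f - f z0, which vanishes at z0. *)
have k0 : (0 < k)%N.
  rewrite lt0n; apply/eqP => k0; move: (nbhs_singleton fa).
  rewrite k0 expr0 mulr1 !subrr sub0r normrN => /norm_le_half_eq0/eqP.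
  by rewrite (negPf a0).
have /nbhs_ballP[e /= e0 Ue] : nbhs z0 (U `&` [set z |
    `|f z - f z0 - a * (z - z0) ^+ k| <= 2^-1 * `|a * (z - z0) ^+ k|]).
  exact: filterI.
pose w := k.-root (v / a).
have wk : a * w ^+ k = v by rewrite rootCK// mulrC divfK.
have w0 : w != 0.
  by apply: contraNneq v0 => w0; rewrite -wk w0 expr0n gtn_eqF// mulr0.
(* This step size satisfies both s <= 1 and s `|w| < e, where e is the radius
   of a ball on which the estimates hold. *)
pose s := e / (`|w| + e) : R[i].
have we0 : 0 < `|w| + e by rewrite addr_gt0 ?normr_gt0.
have s0 : 0 < s by rewrite divr_gt0.
have s1 : s <= 1 by rewrite ler_pdivrMr// mul1r lerDr.
exists (z0 + s * w), (s ^+ k).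
have zb : ball z0 e (z0 + s * w).
  rewrite -ball_normE /ball_/= opprD addNKr normrN normrM gtr0_norm//.
  by rewrite mulrAC ltr_pdivrMr// ltr_pM2l// ltrDl.
have [Uz /=] := Ue _ zb.
have -> : z0 + s * w - z0 = s * w by rewrite addrC addKr.
rewrite exprMn mulrCA wk => fz.
split; [exact: Uz|exact: exprn_gt0|exact: exprn_ile1 (ltW s0) s1|].
rewrite opprD addrA; apply: (le_lt_trans fz).
rewrite normrM gtr0_norm ?exprn_gt0// gtr_pMl ?mulr_gt0 ?normr_gt0 ?exprn_gt0//.
by rewrite invf_lt1// ltr1n.
Qed.
End analytic.

Theorem theorem4p1 (R : realType) (Omega : set R[i]^o) (f : R[i]^o -> R[i]^o)
    (Omega_open : open Omega) (Omega_connected : connected Omega)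
    (f_analytic : analytic_on Omega f) (f_nonconstant : ~ constant_on Omega f) :
  (forall z0 : R[i]^o, Omega z0 ->
     ~ local_max_in Omega (fun z => `|f z|) z0) /\
  (forall z0 : R[i]^o, Omega z0 ->
     local_min_in Omega (fun z => `|f z|) z0 -> f z0 = 0).
Proof.
have moves z0 : Omega z0 -> ~ (\forall z \near z0, f z = f z0).
  by move=> Oz0 /(locally_constant_constant f_analytic Omega_connected Oz0).
split=> z0 Oz0 [_ ext].
  (* Any direction increases the modulus when f z0 = 0. *)
  pose v := if f z0 == 0 then 1 else f z0.
  have v0 : v != 0 by rewrite /v; case: ifPn => //; rewrite oner_eq0.
  have aligned t : 0 < t -> `|f z0 + t * v| = `|f z0| + t * `|v|.
    move=> t0; rewrite /v; case: eqP => [->|_].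
      by rewrite add0r normr0 add0r normrM gtr0_norm.
    rewrite -{1}[f z0]mul1r -mulrDl normrM gtr0_norm ?addr_gt0//.
    by rewrite mulrDl mul1r.
  have near_max : \forall z \near z0, `|f z| <= `|f z0|.
    near=> z; have Oz : Omega z by near: z; exact: open_nbhs_nbhs.
    by move: Oz; near: z.
  have [z [t [/= zmax t0 _ ft]]] :=
    analytic_moves_along f_analytic Oz0 (moves _ Oz0) v0 near_max.
  (* The left-hand side is `|f z0 + t v|; the triangle inequality through f z
     bounds it strictly by the right-hand side. *)
  suff : `|f z0| + t * `|v| < `|f z0| + t * `|v| by rewrite ltxx.
  rewrite -{1}aligned// -{1}(subrK (f z) (f z0 + _)).
  apply: (le_lt_trans (ler_normD _ _)).
  by rewrite distrC addrC ler_ltD.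
apply: contrapT => /eqP fz0.
have near_min : \forall z \near z0, `|f z0| <= `|f z|.
  near=> z; have Oz : Omega z by near: z; exact: open_nbhs_nbhs.
  by move: Oz; near: z.
have nfz0 : - f z0 != 0 by rewrite oppr_eq0.
have [z [t [/= zmin t0 t1 ft]]] :=
  analytic_moves_along f_analytic Oz0 (moves _ Oz0) nfz0 near_min.
suff : `|f z| < `|f z0| by move=> /(le_lt_trans zmin); rewrite ltxx.
rewrite -(subrK (f z0 + t * - f z0) (f z)).
apply: (le_lt_trans (ler_normD _ _)).
have -> : `|f z0 + t * - f z0| = (1 - t) * `|f z0|.
  by rewrite mulrN -{1}[f z0]mul1r -mulrBl normrM ger0_norm ?subr_ge0.
rewrite normrN in ft.
by rewrite mulrBl mul1r -ltrBrDr opprB [ltRHS]addrC subrK.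
Unshelve. all: by end_near. Qed.
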